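(* Any aperiodic shift $(X,\sigma)$ whose complexity function $p_X$ satisfies $$\liminf_{n\to\infty}\bigl(p_X(n+1)-p_X(n)\bigr)<\infty$$ is language stable.
   Context: A shift is a non-empty closed $\sigma$-invariant subset $X$ of $\mathcal{A}^{\mathbb{Z}}$, $\mathcal{A}$ a finite alphabet, where $(\sigma x)_n=x_{n+1}$. It is aperiodic if it contains no $\sigma$-periodic points. $p_X(n)$ is the number of words of length $n$ that occur in elements of $X$. A minimal forbidden word of $X$ is a finite word over $\mathcal{A}$ that occurs in no element of $X$ but all of whose proper subwords occur in elements of $X$; $LS(X)$ is the set of lengths of minimal forbidden words; $X$ is language stable if $\lim_{k\to\infty}\inf_{n\in\mathbb{N}}\frac{|LS(X)\cap[n+1,n+k]|}{k}=0$. *)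

(* Defs.v *)
From mathcomp Require Import all_boot all_order all_algebra.
From mathcomp Require Import finmap.
From mathcomp Require Import all_classical all_reals all_analysis.
Import Order.TTheory GRing.Theory Num.Theory.
Import numFieldNormedType.Exports.

Set Implicit Arguments.
Unset Strict Implicit.
Unset Printing Implicit Defensive.

Local Open Scope classical_set_scope.
Local Open Scope ring_scope.

Definition full_shift (A : finType) :=
  prod_topology (fun _ : int => discrete_topology A).

Definition sigma (A : finType) (x : full_shift A) : full_shift A :=
  fun n => x (n + 1).

(* sigma-invariance is read as sigma(X) = X, the usual convention for two-sided
   subshifts; mere inclusion would allow one-sided orbit closures. *)
Definition is_shift (A : finType) (X : set (full_shift A)) : Prop :=
  [/\ X !=set0, closed X & @sigma A @` X = X].

Definition periodic_point (A : finType) (x : full_shift A) : Prop :=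
  exists2 p : nat, (0 < p)%N & iter p (@sigma A) x = x.

Definition aperiodic (A : finType) (X : set (full_shift A)) : Prop :=
  forall x, X x -> ~ periodic_point x.

Definition occurs_in (A : finType) (w : seq A) (x : full_shift A) : Prop :=
  exists i : int, w = mkseq (fun j => x (i + j%:Z) : A) (size w).

Definition language (A : finType) (X : set (full_shift A)) : set (seq A) :=
  [set w | exists2 x, X x & occurs_in w x].

Definition complexity (A : finType) (X : set (full_shift A)) (n : nat) : nat :=
  #|[set w : n.-tuple A | `[< language X w >]]%SET|.

Definition minimal_forbidden (A : finType) (X : set (full_shift A))
    : set (seq A) :=
  [set w | ~ language X w /\
           forall u : seq A, infix u w -> u != w -> language X u].

Definition LS (A : finType) (X : set (full_shift A)) : set nat :=
  [set size w | w in minimal_forbidden X].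

(* The set is finite, so fset_set gives its true cardinality; the value at k = 0
   is the irrelevant 0 / 0 = 0. *)
Definition LS_density (R : realType) (A : finType) (X : set (full_shift A))
    (k n : nat) : R :=
  #|` fset_set (LS X `&` `[n.+1, (n + k)%N])|%:R / k%:R.

Definition language_stable (R : realType) (A : finType)
    (X : set (full_shift A)) : Prop :=
  (fun k => inf (range (@LS_density R A X k))) @ \oo --> (0 : R).

(* Main.v *)
Require Import Defs.
From mathcomp Require Import all_boot all_order all_algebra.
From mathcomp Require Import all_classical all_reals all_analysis.
From mathcomp Require Import finmap zify.

(** Let [p] be the complexity of [X].  A word of the language with two distinct
    one-letter extensions on the right (a right special word) has at least two
    preimages under the map that truncates words of length [n+1] to length [n],
    so there are at most [p (n+1) - p n] right special words of length [n], and
    likewise for left special words.  The hypothesis on the liminf thus yields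
    a constant [C] and arbitrarily large [n] for which there are at most [C]
    special words of length [n] on either side.

    If [a u b] is a minimal forbidden word, then [u] is special on both sides:
    [a u] and [u b] belong to the language, hence so do some [c u b] and [a u d],
    where [c <> a] and [d <> b] because [a u b] is forbidden.  When [u] has
    length at least [n], its prefix of length [n] is left special and its suffix
    of length [n] is right special: at most [C * C] pairs of words can arise.

    Each pair arises from only one length in [n, n + k - 1], as soon as [n] is
    large with respect to [k].  If the same pair [(l, r)] came from the lengths
    [n + j < n + j'], then [l] and [r] would overlap at the two offsets [j] and
    [j'], and the suffix of [l] of length [n - j] would have period
    [j' - j < k] ([overlap_period]).  By compactness an aperiodic shift has no
    long words with such a small period ([aperiodic_bounded_periods]).

    Hence every [k] admits a window of [k] consecutive integers containing at
    most [C * C] lengths of minimal forbidden words ([card_LS_window]), a bound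
    independent of [k]; dividing by [k] gives language stability. *)

Local Open Scope ring_scope.
Import Order.TTheory GRing.Theory Num.Theory.
Import numFieldNormedType.Exports.

(** * Counting lemmas *)

(** Sum the sizes of the fibres of [f] over [E]: each is at least one, and those
    over [S] are at least two. *)
Lemma leq_card_branching (T U : finType) (f : T -> U) (D : {set T})
    (E S : {set U}) :
  S \subset E ->
  (forall y, y \in E -> exists2 x, x \in D & f x = y) ->
  (forall y, y \in S ->
     exists x x', [/\ x \in D, x' \in D, x != x', f x = y & f x' = y]) ->
  (#|E| + #|S| <= #|D|)%N.
Proof.
move=> SE E1 S2.
have fib y : y \in E -> (1 + (y \in S) <= #|[set x in D | f x == y]%SET|)%N.
  move=> yE; case: (boolP (y \in S)) => [/S2[x [x' [xD x'D xx' fx fx']]]|_].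
    apply/card_gt1P; exists x, x'.
    by split=> //; rewrite inE ?xD ?x'D ?fx ?fx' eqxx.
  have [x xD fx] := E1 y yE.
  by apply/card_gt0P; exists x; rewrite inE xD fx eqxx.
rewrite -(finset.setIidPr SE) -[#|E :&: S|]sum1_card -[#|E|]sum1_card.
under [X in (_ + X)%N]eq_bigl do rewrite inE.
rewrite big_mkcondr -big_split/=.
apply: (@leq_trans (\sum_(y in E) #|[set x in D | f x == y]%SET|)).
  by apply: leq_sum => y yE; apply: leq_trans (fib y yE); case: (y \in S).
rewrite -[#|D|]sum1_card (bigID (fun x => f x \in E))/=.
rewrite (partition_big f (mem E))/=; last by move=> x /andP[].
apply: leq_trans (leq_addr _ _).
apply: leq_sum => y yE; rewrite -sum1_card; apply: eq_leq; apply: eq_bigl => x.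
by rewrite inE; case: eqP => [->|]; rewrite ?andbF// yE !andbT.
Qed.

(** The pigeonhole principle for a relation instead of a map, so that the pair
    of special words attached to a length need not be chosen beforehand. *)
Lemma size_le_card_inj (T : finType) (E : {set T}) (s : seq nat)
    (r : nat -> T -> Prop) :
  uniq s -> (forall m, m \in s -> exists2 p, p \in E & r m p) ->
  (forall m m' p, m \in s -> m' \in s -> r m p -> r m' p -> m = m') ->
  (size s <= #|E|)%N.
Proof.
move=> us rE rinj.
pose f m := [pick p in E | `[< r m p >]].
have fP m : m \in s -> exists p, [/\ f m = Some p, p \in E & r m p].
  move=> ms; rewrite /f; case: pickP => [p /andP[pE /asboolP rp]|h].
    by exists p.
  by have [p pE rp] := rE m ms; have := h p; rewrite pE /= asboolT.
rewrite -(size_map f) cardE -(size_map Some (enum E)); apply: uniq_leq_size.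
  rewrite map_inj_in_uniq// => m m' ms m's.
  have [p [-> _ rp]] := fP m ms; have [p' [-> _ rp']] := fP m' m's.
  by move=> [pp']; apply: (rinj m m' p) => //; rewrite pp'.
move=> _ /mapP[m ms ->]; have [p [-> pE _]] := fP m ms.
by apply: map_f; rewrite mem_enum.
Qed.

Lemma finite_window (a b : nat) (B : set nat) :
  finite_set (B `&` `[a, b])%classic.
Proof.
apply: (@sub_finite_set _ _ `I_b.+1); last exact: finite_II.
by move=> m [_]/=; rewrite in_itv/= => /andP[].
Qed.

(** * The language of a set of configurations *)

Definition window {A : finType} (x : full_shift A) (i : int) (n : nat) : seq A :=
  mkseq (fun j => x (i + j%:Z) : A) n.

Lemma size_window {A : finType} (x : full_shift A) (i : int) (n : nat) :
  size (window x i n) = n.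
Proof. exact: size_mkseq. Qed.

Lemma window_cat {A : finType} (x : full_shift A) (i : int) (m n : nat) :
  window x i (m + n) = window x i m ++ window x (i + m%:Z) n.
Proof.
rewrite /window /mkseq iotaD map_cat; congr (_ ++ _).
rewrite add0n -{1}[m]addn0 iotaDl -map_comp.
by apply: eq_map => j /=; rewrite PoszD addrA.
Qed.

Lemma window_cat_inv {A : finType} (x : full_shift A) (i : int) (u v : seq A) :
  u ++ v = window x i (size (u ++ v)) ->
  u = window x i (size u) /\ v = window x (i + (size u)%:Z) (size v).
Proof.
rewrite size_cat window_cat => /eqP.
by rewrite eqseq_cat ?size_window// => /andP[/eqP <- /eqP <-].
Qed.

Lemma language_window {A : finType} (X : set (full_shift A)) (x : full_shift A)
    (i : int) (n : nat) :
  X x -> language X (window x i n).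
Proof. by move=> Xx; exists x => //; exists i; rewrite size_window. Qed.

Lemma languageE {A : finType} (X : set (full_shift A)) (w : seq A) :
  language X w -> exists x, X x /\ exists i, w = window x i (size w).
Proof. by move=> [x Xx [i wE]]; exists x; split=> //; exists i. Qed.

Lemma language_infix {A : finType} (X : set (full_shift A)) (u w : seq A) :
  infix u w -> language X w -> language X u.
Proof.
move=> /infixP[s [t ->]] /languageE[x [Xx [i]]].
by move=> /window_cat_inv[_ /window_cat_inv[-> _]]; exact: language_window.
Qed.

Lemma language_rcons {A : finType} (X : set (full_shift A)) (w : seq A) :
  language X w -> exists a, language X (rcons w a).
Proof.
move=> /languageE[x [Xx [i wE]]]; exists (x (i + (size w)%:Z)).
have := language_window X x i (size w + 1) Xx.
by rewrite window_cat -wE /window /mkseq/= addr0 cats1.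
Qed.

Lemma language_cons {A : finType} (X : set (full_shift A)) (w : seq A) :
  language X w -> exists a, language X (a :: w).
Proof.
move=> /languageE[x [Xx [i wE]]]; exists (x (i - 1)).
have := language_window X x (i - 1) (1 + size w) Xx.
by rewrite window_cat subrK -wE /window /mkseq/= addr0.
Qed.

(** * Special words *)

Definition right_special {A : finType} (X : set (full_shift A)) (u : seq A) :=
  exists a b, [/\ a != b, language X (rcons u a) & language X (rcons u b)].

Definition left_special {A : finType} (X : set (full_shift A)) (u : seq A) :=
  exists a b, [/\ a != b, language X (a :: u) & language X (b :: u)].

Definition words {A : finType} (X : set (full_shift A)) (n : nat) :
    {set n.-tuple A} :=
  [set w : n.-tuple A | `[< language X w >]]%SET.

Definition right_specials {A : finType} (X : set (full_shift A)) (n : nat) :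
    {set n.-tuple A} :=
  [set w : n.-tuple A | `[< right_special X w >]]%SET.

Definition left_specials {A : finType} (X : set (full_shift A)) (n : nat) :
    {set n.-tuple A} :=
  [set w : n.-tuple A | `[< left_special X w >]]%SET.

Lemma card_right_specials {A : finType} (X : set (full_shift A)) (n : nat) :
  (#|words X n| + #|right_specials X n| <= #|words X n.+1|)%N.
Proof.
pose f (w : n.+1.-tuple A) : n.-tuple A := [tuple of belast (thead w) (behead w)].
have fE (w : n.-tuple A) a : f [tuple of rcons w a] = w.
  apply: val_inj => /=; rewrite /thead (tnth_nth a)/=.
  by case: {+}(val w) => //= b s; rewrite belast_rcons.
have mem (w : n.-tuple A) a :
    language X (rcons w a) -> [tuple of rcons w a] \in words X n.+1.
  by move=> h; rewrite inE; apply/asboolP.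
apply: (@leq_card_branching _ _ f).
- apply/fintype.subsetP => w; rewrite !inE => /asboolP[a [b [_ wa _]]].
  by apply/asboolP; apply: language_infix wa; rewrite -cats1 prefix_infix.
- move=> w; rewrite inE => /asboolP /language_rcons[a wa].
  by exists [tuple of rcons w a]; [exact: mem|exact: fE].
- move=> w; rewrite inE => /asboolP[a [b [ab wa wb]]].
  exists [tuple of rcons w a], [tuple of rcons w b].
  split; [exact: mem|exact: mem| |exact: fE|exact: fE].
  by apply: contraNneq ab => /(congr1 val)/= /rcons_inj[->].
Qed.

Lemma card_left_specials {A : finType} (X : set (full_shift A)) (n : nat) :
  (#|words X n| + #|left_specials X n| <= #|words X n.+1|)%N.
Proof.
pose f (w : n.+1.-tuple A) : n.-tuple A := [tuple of behead w].
have fE (w : n.-tuple A) a : f [tuple of a :: w] = w by exact: val_inj.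
have mem (w : n.-tuple A) a :
    language X (a :: w) -> [tuple of a :: w] \in words X n.+1.
  by move=> h; rewrite inE; apply/asboolP.
apply: (@leq_card_branching _ _ f).
- apply/fintype.subsetP => w; rewrite !inE => /asboolP[a [b [_ wa _]]].
  by apply/asboolP; apply: language_infix wa; rewrite -cat1s suffix_infix.
- move=> w; rewrite inE => /asboolP /language_cons[a wa].
  by exists [tuple of a :: w]; [exact: mem|exact: fE].
- move=> w; rewrite inE => /asboolP[a [b [ab wa wb]]].
  exists [tuple of a :: w], [tuple of b :: w].
  split; [exact: mem|exact: mem| |exact: fE|exact: fE].
  by apply: contraNneq ab => /(congr1 val)/= -[->].
Qed.

(** Write [w = a u b]: the word [u b] extends to the left by a letter, which
    cannot be [a] because [w] is forbidden, and symmetrically for [a u]. *)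
Lemma minimal_forbidden_bispecial {A : finType} (X : set (full_shift A))
    (w : seq A) :
  minimal_forbidden X w -> (1 < size w)%N ->
  exists u : seq A,
    [/\ size w = (size u).+2, left_special X u & right_special X u].
Proof.
case: w => [//|a w]; case/lastP: w => [//|u b] [nw sub] _.
have La : language X (a :: u).
  apply: sub; first by rewrite -cats1 -cat_cons prefix_infix.
  by apply/eqP => /(congr1 size)/=; rewrite size_rcons; lia.
have Lb : language X (rcons u b).
  apply: sub; first by rewrite -[a :: _]cat1s suffix_infix.
  by apply/eqP => /(congr1 size)/=; lia.
exists u; rewrite /= size_rcons; split=> //.
- have [c Lc] := language_cons _ _ Lb; exists a, c; split=> //.
    by apply: contra_notN nw => /eqP ->.
  by apply: language_infix Lc; rewrite -cats1 -cat_cons prefix_infix.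
- have [c Lc] := language_rcons _ _ La; exists b, c; split=> //.
    by apply: contra_notN nw => /eqP ->; rewrite -rcons_cons.
  by apply: language_infix Lc; rewrite rcons_cons -[a :: _]cat1s suffix_infix.
Qed.

Lemma bispecial_ends {A : finType} (X : set (full_shift A)) (n : nat)
    (u : seq A) :
  (n <= size u)%N -> left_special X u -> right_special X u ->
  exists2 p : n.-tuple A * n.-tuple A,
    p \in finset.setX (left_specials X n) (right_specials X n)
    & val p.1 = take n u /\ val p.2 = drop (size u - n) u.
Proof.
move=> nu [a [c [ac La Lc]]] [b [d [bd Lb Ld]]].
have st : size (take n u) == n by rewrite size_takel.
have sd : size (drop (size u - n) u) == n by rewrite size_drop subKn.
exists (Tuple st, Tuple sd) => //.
rewrite inE/=; apply/andP; split; rewrite inE; apply/asboolP.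
  exists a, c; split=> //=; [apply: language_infix La|apply: language_infix Lc];
    by rewrite -{2}(cat_take_drop n u) -cat_cons prefix_infix.
exists b, d; split=> //=; [apply: language_infix Lb|apply: language_infix Ld];
  by rewrite -{3}(cat_take_drop (size u - n) u) rcons_cat suffix_infix.
Qed.

(** * Periods of words *)

Definition has_period {T : eqType} (d : nat) (w : seq T) :=
  drop d w == take (size w - d) w.

(** Both [drop j l] and [drop j' l] are prefixes of [r], since [u] and [u']
    begin with [l] and continue as [r] from the offsets [j] and [j'] on; so the
    first of them, shifted by [j' - j], agrees with itself. *)
Lemma overlap_period {T : eqType} (j j' n : nat) (l r u u' : seq T) :
  (j <= j' <= n)%N -> size l = n ->
  take n u = l -> drop j u = r -> take n u' = l -> drop j' u' = r ->
  has_period (j' - j) (drop j l).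
Proof.
move=> /andP[jj' j'n] sl ul ur u'l u'r.
rewrite /has_period drop_drop subnK// size_drop sl.
rewrite -{1}u'l -[in X in _ == X]ul.
rewrite -[in X in drop j' (take X _)](subnK j'n) -take_drop.
rewrite -[in X in _ == X](subnK (leq_trans jj' j'n)) -take_drop ur u'r addnK.
by rewrite take_takel; [apply/eqP; congr take; lia|lia].
Qed.

Lemma window_period {A : finType} (x : full_shift A) (i : int) (n d t : nat) :
  has_period d (window x i n) -> (t + d < n)%N ->
  x (i + t%:Z) = x (i + (t + d)%:Z).
Proof.
rewrite /has_period size_window => /eqP h tn.
have := congr1 (fun s => nth (x i) s t) h.
rewrite nth_drop nth_take ?ltn_subRL; last by rewrite addnC.
rewrite !nth_mkseq ?[(d + t)%N]addnC//.
by apply: leq_ltn_trans tn; exact: leq_addr.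
Qed.

(** * Compactness *)

Lemma iter_sigma {A : finType} (x : full_shift A) (n : nat) (i : int) :
  iter n (@sigma A) x i = x (i + n%:Z).
Proof.
elim: n i => [|n IH] i /=; first by rewrite addr0.
by rewrite /sigma IH -addrA; congr (x (_ + _)); lia.
Qed.

Lemma shift_translate {A : finType} (X : set (full_shift A))
    (x : full_shift A) (z : int) :
  is_shift X -> X x -> X (fun i => x (i + z)).
Proof.
move=> [_ _ sX] Xx.
have sigmaX y : X y -> X (sigma y) by move=> Xy; rewrite -sX; exists y.
case: z => n.
  elim: n => [|n IH].
    by rewrite (_ : (fun _ => _) = x)//; apply: funext => i; rewrite addr0.
  rewrite (_ : (fun _ => _) = sigma (fun i => x (i + n%:Z))).
    exact: sigmaX.
  by apply: funext => i; rewrite /sigma; congr (x _); lia.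
(* Translating to the left uses that sigma maps X onto X. *)
elim: n => [|n IH].
  move: Xx; rewrite -{1}sX => -[y Xy <-].
  rewrite (_ : (fun _ => _) = y)//; apply: funext => i.
  by rewrite /sigma; congr (y _); lia.
move: IH; rewrite -{1}sX => -[y Xy yE].
rewrite (_ : (fun _ => _) = y)//; apply: funext => i.
have := congr1 (fun f : full_shift A => f (i - 1)) yE.
by rewrite /sigma subrK => ->; congr (x _); lia.
Qed.

Lemma shift_compact {A : finType} (X : set (full_shift A)) :
  is_shift X -> compact X.
Proof.
move=> [_ clX _].
have compactT : compact [set: full_shift A].
  rewrite (_ : setT = [set f : full_shift A | forall i, setT (f i)])%classic.
    apply: (@tychonoff int (fun _ => discrete_topology A) (fun _ => setT)) => i.
    by apply: finite_compact; exact: finite_finset.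
  by apply/seteqP; split.
exact: subclosed_compact clX compactT (@subsetT _ _).
Qed.

Lemma nbhs_coordinate {A : finType} (y : full_shift A) (t : int) :
  nbhs y [set z : full_shift A | z t = y t]%classic.
Proof. exact: (@proj_continuous _ _ t y _ (discrete_set1 _)). Qed.

(** Otherwise, translating longer and longer words of period [d] gives points
    [x N] of [X] that are [d]-periodic at all coordinates of absolute value at
    most [N]; any cluster point of this sequence is a periodic point of [X]. *)
Lemma aperiodic_bounded_period {A : finType} (X : set (full_shift A)) (d : nat) :
  is_shift X -> aperiodic X -> (0 < d)%N ->
  exists N, forall w, language X w -> (N <= size w)%N -> ~~ has_period d w.
Proof.
move=> sX aX d0; apply: contrapT => noN.
have /choice[x xP] : forall N : nat, exists x, X x /\
    forall t : int, (`|t| <= N)%N -> x t = x (t + d%:Z).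
  move=> N; apply: contrapT => nox; apply: noN.
  (* A centred window [-N, N], followed by d more letters. *)
  exists (N + N + d).+1 => w Lw Nw.
  apply/negP => pw; apply: nox.
  have [y [Xy [i wE]]] := languageE _ _ Lw.
  exists (fun t => y (t + (i + N%:Z))); split.
    exact: (shift_translate X y (i + N%:Z)).
  rewrite wE in pw => t tN.
  pose s := `|(t + N%:Z)%R|%N.
  have := window_period _ _ _ _ s pw; move=> /(_ ltac:(lia)) ys.
  by transitivity (y (i + s%:Z)); [congr (y _)|rewrite ys; congr (y _)]; lia.
have [|y [Xy yc]] := shift_compact X sX (x @ \oo)%classic _ _.
  by exists 0%N => // N _; case: (xP N).
apply: (aX y Xy); exists d => //; apply: funext => i; rewrite iter_sigma.
(* Some x N with N >= |i| agrees with y at the coordinates i and i + d. *)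
have [z [[N iN ->] [/= <- <-]]] : (
   [set z | exists2 N : nat, (`|i| <= N)%N & z = x N] `&`
   ([set z : full_shift A | z i = y i] `&`
    [set z : full_shift A | z (i + d%:Z) = y (i + d%:Z)]) !=set0)%classic.
  apply: yc; last by apply: filterI; exact: nbhs_coordinate.
  by exists `|i|%N => // N /= hN; exists N.
by have [_ /(_ i iN)] := xP N.
Qed.

Lemma aperiodic_bounded_periods {A : finType} (X : set (full_shift A)) (k : nat) :
  is_shift X -> aperiodic X ->
  exists N, forall w d, language X w -> (0 < d < k)%N -> (N <= size w)%N ->
    ~~ has_period d w.
Proof.
move=> sX aX; elim: k => [|k [N hN]]; first by exists 0%N => w d _; lia.
case: (posnP k) => [k0|k0]; first by exists 0%N => w d _; lia.
have [M hM] := aperiodic_bounded_period _ _ sX aX k0.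
exists (maxn N M) => w d Lw dk; rewrite geq_max => /andP[Nw Mw].
case: (eqVneq d k) => [->|dnk]; first exact: hM.
by apply: hN => //; lia.
Qed.

(** * Sparse windows of lengths of minimal forbidden words *)

(** A length [m] in the window is sent to the prefix and the suffix of length
    [n] of a word [u] of length [m - 2] that is special on both sides.  The
    window starts at [n + 2] so that [u] has length at least [n]; its length
    then ranges over [k] values, and two of them cannot share the same ends. *)
Lemma card_LS_window {A : finType} (X : set (full_shift A)) (n k N C : nat) :
  (forall w d, language X w -> (0 < d < k)%N -> (N <= size w)%N ->
     ~~ has_period d w) ->
  (N + k <= n)%N -> (complexity X n.+1 <= complexity X n + C)%N ->
  (#|` fset_set (LS X `&` `[n.+2, (n.+1 + k)%N])%classic| <= C * C)%N.
Proof.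
move=> noper Nn cC.
set B := (X in fset_set X).
have finB : finite_set B by exact: finite_window.
have memB m : m \in fset_set B -> B m by rewrite in_fset_set// => /set_mem.
have leL : (#|left_specials X n| <= C)%N.
  by rewrite -(leq_add2l #|words X n|) (leq_trans (card_left_specials X n)).
have leR : (#|right_specials X n| <= C)%N.
  by rewrite -(leq_add2l #|words X n|) (leq_trans (card_right_specials X n)).
apply: leq_trans (leq_mul leL leR); rewrite -cardsX.
pose r m (p : n.-tuple A * n.-tuple A) := exists u : seq A, [/\ language X u,
  m = (size u).+2, val p.1 = take n u & val p.2 = drop (size u - n) u].
apply: (@size_le_card_inj _ _ _ r); first exact: fset_uniq.
  move=> m /memB[[w mw <-]] /=; rewrite in_itv/= !leEnat => /andP[lo hi].
  have [|u [wu lu ru]] := minimal_forbidden_bispecial _ _ mw; first by lia.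
  have [|p pE [p1 p2]] := bispecial_ends _ n _ _ lu ru; first by lia.
  exists p => //; exists u; split=> //.
  case: lu => a [b [_ La _]]; apply: language_infix La.
  by rewrite -cat1s suffix_infix.
have noinj m m' p : m \in fset_set B -> m' \in fset_set B -> r m p -> r m' p ->
    (m < m')%N -> False.
  move=> /memB[_ +] /memB[_ +] [u [Lu mE pu1 pu2]] [u' [_ m'E pu'1 pu'2]] mm'.
  rewrite /= !in_itv/= !leEnat => /andP[lo hi] /andP[lo' hi'].
  have := overlap_period (size u - n) (size u' - n) n p.1 p.2 u u'.
  rewrite size_tuple -pu1 -pu2 -pu'1 -pu'2.
  move=> /(_ ltac:(lia) erefl erefl erefl erefl erefl); apply/negP.
  apply: noper; [|lia|by rewrite size_drop size_tuple; lia].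
  apply: language_infix Lu.
  apply: (@infix_trans _ (val p.1)); first exact: infix_drop.
  by rewrite pu1 infix_take.
move=> m m' p mB m'B rm rm'; case: (ltngtP m m') => // [mm'|m'm].
  by case: (noinj m m' p).
by case: (noinj m' m p).
Qed.

(** * Language stability *)

Lemma limn_einf_lt_pinfty (R : realType) (u : nat -> R) :
  (limn_einf (fun n => (u n)%:E) < +oo)%E ->
  exists C : nat, forall n, exists2 m, (n <= m)%N & u m <= C%:R.
Proof.
rewrite limn_einf_lim (cvg_lim _ (@cvg_einfs_sup _ _))// => lt_oo.
set L := ereal_sup _ in lt_oo.
have [C LC] : exists C : nat, (L < C%:R%:E)%E.
  move: lt_oo; case: L => [r _|//|_]; last by exists 0%N; rewrite ltNyr.
  exists (Num.bound `|r|).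
  by rewrite lte_fin (le_lt_trans (ler_norm r))// archi_boundP ?normr_ge0.
exists C => n.
have : (einfs (fun n => (u n)%:E) n < C%:R%:E)%E.
  by apply: le_lt_trans LC; apply: ereal_sup_ubound; exists n.
rewrite /einfs => /ereal_inf_lt[_ [m /= nm <-]].
by rewrite lte_fin => /ltW; exists m.
Qed.

Lemma language_stable_bounded (R : realType) {A : finType}
    (X : set (full_shift A)) (C : nat) :
  (forall k, exists n,
     #|` fset_set (LS X `&` `[n.+1, (n + k)%N])%classic| <= C)%N ->
  language_stable R X.
Proof.
move=> bnd.
have dens0 k : lbound (range (@LS_density R A X k)) 0.
  by move=> _ [n _ <-]; rewrite /LS_density divr_ge0// ler0n.
apply/cvgrPdist_lt => e e0; near=> k.
have k0 : (0 < k%:R :> R) by rewrite ltr0n; near: k; exact: nbhs_infty_gt.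
rewrite sub0r normrN ger0_norm; last first.
  apply: lb_le_inf; last exact: dens0.
  by exists (@LS_density R A X k 0%N); exists 0%N.
have [n nC] := bnd k.
apply: (@le_lt_trans _ _ (@LS_density R A X k n)).
  by apply: ge_inf; [exists 0; exact: dens0|exists n].
rewrite /LS_density ltr_pdivrMr//.
apply: (@le_lt_trans _ _ C%:R); first by rewrite ler_nat.
by rewrite mulrC -ltr_pdivrMr//; near: k; exact: nbhs_infty_gtr.
Unshelve. all: by end_near. Qed.

Theorem corollary6p2 (R : realType) (A : finType) (X : set (full_shift A))
    (hX : is_shift X) (hap : aperiodic X)
    (hliminf : (limn_einf (fun n : nat =>
       ((complexity X n.+1)%:R - (complexity X n)%:R : R)%:E) < +oo)%E) :
  language_stable R X.
Proof.
have [C hC] := limn_einf_lt_pinfty _ _ hliminf.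
apply: (language_stable_bounded _ _ (C * C)) => k.
have [N hN] := aperiodic_bounded_periods _ k hX hap.
have [n Nn nC] := hC (N + k)%N.
exists n.+1; apply: card_LS_window hN Nn _.
by rewrite -(ler_nat R) natrD -lerBlDl.
Qed.
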